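(* Let $D\subset\mathbb{R}^P$ be compact and let $A(\mu)=\theta_1(\mu)A_1+\dots+\theta_Q(\mu)A_Q$ for $\mu\in D$, with Hermitian $A_1,\dots,A_Q\in\mathbb{C}^{N\times N}$ and functions $\theta_1,\dots,\theta_Q:D\to\mathbb{R}$. Let $C_J=\{\mu_1,\dots,\mu_J\}\subseteq D$, let $\lambda_{\mathrm{LB}}(\mu;C_J)$ be the SCM lower bound for $A(\mu)$ defined in the context, and let $\tilde\mu\in D$. If $J<N$, then there exist Hermitian matrices $\bar A_1,\dots,\bar A_Q\in\mathbb{C}^{N\times N}$ such that, with $\bar A(\mu)=\theta_1(\mu)\bar A_1+\dots+\theta_Q(\mu)\bar A_Q$, $$\lambda_{\min}(\bar A(\tilde\mu))=\lambda_{\mathrm{LB}}(\tilde\mu;C_J)\qquad\text{and}\qquad \lambda_{\min}(\bar A(\mu_i))=\lambda_{\min}(A(\mu_i))\quad\text{for } i=1,\dots,J.$$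
   Context: $\lambda_{\min}(\cdot)$, $\lambda_{\max}(\cdot)$ denote the smallest and largest eigenvalues of a Hermitian matrix. Put $\theta(\mu)=[\theta_1(\mu),\dots,\theta_Q(\mu)]^T\in\mathbb{R}^Q$ and $\lambda_i=\lambda_{\min}(A(\mu_i))$. Define the bounding box $$\mathcal{B}=[\lambda_{\min}(A_1),\lambda_{\max}(A_1)]\times\cdots\times[\lambda_{\min}(A_Q),\lambda_{\max}(A_Q)]\subseteq\mathbb{R}^Q,$$ the polytope $$\mathcal{Y}_{\mathrm{LB}}(C_J)=\{y\in\mathcal{B}:\ \theta(\mu_i)^Ty\ge\lambda_i,\ i=1,\dots,J\},$$ and the lower bound $$\lambda_{\mathrm{LB}}(\mu;C_J)=\min_{y\in\mathcal{Y}_{\mathrm{LB}}(C_J)}\theta(\mu)^Ty .$$ *)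

(* Defs.v *)
From HB Require Import structures.
From mathcomp Require Import all_boot all_order all_algebra.
From mathcomp Require Import complex.
From mathcomp Require Import boolp classical_sets reals topology normedtype.

Set Implicit Arguments.
Unset Strict Implicit.
Unset Printing Implicit Defensive.

Import Order.TTheory GRing.Theory Num.Theory.
Import numFieldNormedType.Exports.

Local Open Scope classical_set_scope.
Local Open Scope ring_scope.

(* If S has no least (greatest) element, [min_set S] ([max_set S]) is 0. *)
Definition min_set (R : realType) (S : set R) : R :=
  xget 0 [set m | S m /\ lbound S m].

Definition max_set (R : realType) (S : set R) : R :=
  xget 0 [set m | S m /\ ubound S m].

Lemma min_setE (R : realType) (S : set R) (m : R) :
  S m -> lbound S m -> min_set S = m.
Proof.
move=> Sm mS; apply: xget_unique => // x [Sx xS].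
by apply/eqP; rewrite eq_le xS// mS.
Qed.

Lemma max_setE (R : realType) (S : set R) (m : R) :
  S m -> ubound S m -> max_set S = m.
Proof.
move=> Sm mS; apply: xget_unique => // x [Sx xS].
by apply/eqP; rewrite eq_le xS// mS.
Qed.

(* The eigenvalues of a Hermitian matrix are all real, so that ranging over the
   real numbers loses none of them. *)
Definition real_spectrum (R : realType) (N : nat) (M : 'M[R[i]]_N) : set R :=
  [set l : R | eigenvalue M (l%:C)%C].

Definition lambda_min (R : realType) (N : nat) (M : 'M[R[i]]_N) : R :=
  min_set (real_spectrum M).

Definition lambda_max (R : realType) (N : nat) (M : 'M[R[i]]_N) : R :=
  max_set (real_spectrum M).

Section SCM.
Variables (R : realType) (P Q N J : nat).

(* The functions theta_q are total; only their values on D are ever used. *)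
Implicit Types (theta : 'I_Q -> 'cV[R]_P -> R) (A : 'I_Q -> 'M[R[i]]_N).
Implicit Types (mu : 'cV[R]_P) (C : 'I_J -> 'cV[R]_P) (y : 'cV[R]_Q).

Definition affine_mx theta A mu : 'M[R[i]]_N :=
  \sum_(q < Q) ((theta q mu)%:C)%C *: A q.

Definition theta_dot theta mu y : R := \sum_(q < Q) theta q mu * y q 0.

Definition bounding_box A : set 'cV[R]_Q :=
  [set y | forall q, lambda_min (A q) <= y q 0 <= lambda_max (A q)].

Definition Y_LB theta A C : set 'cV[R]_Q :=
  [set y | bounding_box A y /\
     forall i, lambda_min (affine_mx theta A (C i)) <= theta_dot theta (C i) y].

Definition lambda_LB theta A C mu : R :=
  min_set [set theta_dot theta mu y | y in Y_LB theta A C].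

End SCM.

(* Main.v *)
(* With v_i a unit eigenvector for lambda_min (A(mu_i)), the vector y_i of
   Rayleigh quotients of A_1, ..., A_Q at v_i lies in Y_LB and satisfies
   theta(mu_i)^T y_i = lambda_i; let y_0 in Y_LB attain lambda_LB(mu~).  Taking
   for Abar_q the diagonal matrix listing the q-th coordinates of y_1, ..., y_J
   and then of y_0 (J < N leaves room for it), the eigenvalues of Abar(mu) are
   the theta(mu)^T y_k.  Since all the y_k lie in Y_LB, the smallest one is
   attained at y_i for mu = mu_i and at y_0 for mu = mu~. *)
Require Import Defs.
From HB Require Import structures.
From mathcomp Require Import all_boot all_order all_algebra.
From mathcomp Require Import complex.
From mathcomp Require Import boolp classical_sets reals topology normedtype.
From mathcomp Require Import derive.

Set Implicit Arguments.
Unset Strict Implicit.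
Unset Printing Implicit Defensive.

Import Order.TTheory GRing.Theory Num.Theory.
Import numFieldNormedType.Exports.

Local Open Scope classical_set_scope.
Local Open Scope ring_scope.
Local Open Scope sesquilinear_scope.

Definition real_diag_mx (R : realType) (N : nat) (d : 'I_N -> R) : 'M[R[i]]_N :=
  diag_mx (\row_k ((d k)%:C)%C).

(** The division by the squared norm is left out, so this is the Rayleigh quotient for unit [x]
    only. Vectors are rows because [eigenvalue] refers to left eigenvectors. *)
Definition rayleigh (R : realType) (N : nat) (M : 'M[R[i]]_N) (x : 'rV[R[i]]_N)
    : R :=
  complex.Re ((x *m M *m x ^t*) 0 0).

(** * Spectra and Rayleigh quotients of Hermitian matrices *)

Section Spectrum.
Variables (R : realType) (N : nat).
Implicit Types (M P : 'M[R[i]]_N) (d : 'I_N -> R) (x : 'rV[R[i]]_N).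

Lemma real_diag_mx_hermsym d : real_diag_mx d \is hermsymmx.
Proof.
apply/is_hermitianmxP; rewrite expr0 scale1r tr_diag_mx map_diag_mx.
congr diag_mx; apply/rowP => k; rewrite !mxE.
by apply/esym/CrealP/complex_realP; exists (d k).
Qed.

(** If [v] is a left eigenvector, then [v *m invmx P] is one of the diagonal matrix, and any nonzero
    coordinate of it identifies the eigenvalue. Conversely, row [k] of [P] is an eigenvector for
    [d k]. *)
Lemma real_spectrum_similar_diag P d : P \in unitmx ->
  real_spectrum (invmx P *m real_diag_mx d *m P) = range d.
Proof.
move=> uP; apply/seteqP; split=> [a /= /eigenvalueP[v va v0]|_ [k _ <-] /=].
- pose w := v *m invmx P.
  have wD : w *m real_diag_mx d = (a%:C)%C *: w.
    by rewrite -[LHS](mulmxK uP) scalemxAl -va !mulmxA.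
  have /rV0Pn[k wk0] : w != 0.
    apply: contraNneq v0 => w0.
    by rewrite -[v](mulmxKV uP) -/w w0 mul0mx.
  exists k => //; apply/complexI/(mulIf wk0).
  have := congr1 (fun u : 'rV_N => u 0 k) wD.
  by rewrite mul_mx_diag !mxE mulrC.
- apply/eigenvalueP; exists (delta_mx 0 k *m P).
    rewrite !mulmxA mulmxK// scalemxAl; congr (_ *m _).
    rewrite mul_mx_diag; apply/rowP => j; rewrite !mxE/=.
    by have [->|] := eqVneq j k; rewrite ?mulr1 ?mul1r// mulr0 mul0r.
  apply/eqP => /(congr1 (mulmx^~ (invmx P))).
  rewrite mulmxK// mul0mx => /(congr1 (fun u : 'rV_N => u 0 k)).
  by rewrite !mxE !eqxx => /eqP; rewrite oner_eq0.
Qed.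

Lemma lambda_min_similar_diag P d k : P \in unitmx ->
  (forall j, d k <= d j) ->
  lambda_min (invmx P *m real_diag_mx d *m P) = d k.
Proof.
move=> uP dk; rewrite /lambda_min real_spectrum_similar_diag//.
by apply: min_setE; [exists k | move=> _ [j _ <-]].
Qed.

Lemma lambda_max_similar_diag P d k : P \in unitmx ->
  (forall j, d j <= d k) ->
  lambda_max (invmx P *m real_diag_mx d *m P) = d k.
Proof.
move=> uP dk; rewrite /lambda_max real_spectrum_similar_diag//.
by apply: max_setE; [exists k | move=> _ [j _ <-]].
Qed.

Lemma lambda_min_real_diag d k :
  (forall j, d k <= d j) -> lambda_min (real_diag_mx d) = d k.
Proof.
move=> dk; rewrite -(lambda_min_similar_diag (unitmx1 _ _) dk).
by rewrite invmx1 mul1mx mulmx1.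
Qed.

(** The spectral theorem; taking real parts of the diagonal loses nothing, since the eigenvalues of
    a Hermitian matrix are real. *)
Lemma hermsym_real_diag M : M \is hermsymmx ->
  exists P d, P \is unitarymx /\ M = invmx P *m real_diag_mx d *m P.
Proof.
move=> hM; exists (spectralmx M), (fun k => complex.Re (spectral_diag M 0 k)).
split; first exact: spectral_unitarymx.
have -> : real_diag_mx (fun k => complex.Re (spectral_diag M 0 k)) =
    diag_mx (spectral_diag M).
  rewrite /real_diag_mx; congr diag_mx; apply/rowP => k; rewrite mxE RRe_real//.
  exact: (mxOverP (hermitian_spectral_diag_real hM)).
exact/orthomx_spectralP/hermitian_normalmx.
Qed.

(** In the orthonormal basis formed by the rows of [P], the quadratic form is a sum of eigenvalues
    weighted by the squared moduli of the coordinates of [x]. *)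
Lemma unitary_diag_quadE P d x : P \is unitarymx ->
  (x *m (invmx P *m real_diag_mx d *m P) *m x ^t*) 0 0 =
  \sum_k ((d k)%:C)%C * `|(x *m P ^t*) 0 k| ^+ 2.
Proof.
move=> uP; rewrite invmx_unitary// !mulmxA -[_ *m P *m _]mulmxA.
have -> : P *m x ^t* = (x *m P ^t*) ^t* by rewrite trmx_mul map_mxM trmxCK.
rewrite mxE; apply: eq_bigr => k _.
rewrite mul_mx_diag normCK !mxE mulrA; congr (_ * _).
by rewrite mulrC.
Qed.

(** The preceding formula with all eigenvalues equal to 1, where the matrix in the middle is the
    identity. *)
Lemma unitary_weights_sum P x : P \is unitarymx -> x *m x ^t* = 1%:M ->
  \sum_k `|(x *m P ^t*) 0 k| ^+ 2 = 1.
Proof.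
move=> uP x1; have := unitary_diag_quadE (fun=> 1) x uP.
have -> : real_diag_mx (fun=> 1) = 1%:M :> 'M[R[i]]_N.
  by apply/matrixP => j k; rewrite !mxE.
rewrite mulmx1 mulVmx ?unitarymx_unit// mulmx1 x1 [X in X = _]mxE eqxx.
by move=> /esym; under eq_bigr do rewrite mul1r.
Qed.

(** At a unit vector the Rayleigh quotient is a convex combination of the eigenvalues. *)
Lemma rayleigh_bounds M x : M \is hermsymmx -> x *m x ^t* = 1%:M ->
  lambda_min M <= rayleigh M x <= lambda_max M.
Proof.
move=> /hermsym_real_diag[P [d [uP ->]]] x1.
have w1 := unitary_weights_sum uP x1.
(* For N = 0 the weights would sum to 0 instead of 1. *)
have k0 : 'I_N.
  case: (pickP (fun _ : 'I_N => true)) => [//|no].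
  by move: w1; rewrite big_pred0// => /esym/eqP; rewrite oner_eq0.
have [kmin _ dmin] := @arg_minP _ _ _ k0 xpredT d isT.
have [kmax _ dmax] := @arg_maxP _ _ _ k0 xpredT d isT.
rewrite (lambda_min_similar_diag (k := kmin)) ?unitarymx_unit//; last first.
  by move=> j; exact: dmin.
rewrite (lambda_max_similar_diag (k := kmax)) ?unitarymx_unit//; last first.
  by move=> j; exact: dmax.
rewrite /rayleigh unitary_diag_quadE//; set z := \sum_k _.
(* Both bounds are multiplied by the total weight 1 and compared term by term. The order on [R[i]]
   requires equal imaginary parts, so the inequality of real parts is extracted at the end. *)
have : (((d kmin)%:C)%C <= z) && (z <= ((d kmax)%:C)%C).
  rewrite -[X in X <= z]mulr1 -[X in _ && (z <= X)]mulr1 -w1 !mulr_sumr.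
  by apply/andP; split; apply: ler_sum => k _;
    rewrite ler_wpM2r ?exprn_ge0// lecR; [exact: dmin | exact: dmax].
by rewrite !lecE/= => /andP[/andP[_ ->] /andP[_ ->]].
Qed.

(** The row of the diagonalizing unitary matrix at the index of a smallest eigenvalue puts all the
    weight on that eigenvalue. *)
Lemma rayleigh_lambda_min M : (0 < N)%N -> M \is hermsymmx ->
  exists2 x : 'rV_N, x *m x ^t* = 1%:M & rayleigh M x = lambda_min M.
Proof.
move=> N0 /hermsym_real_diag[P [d [uP ->]]].
have [k _ dk] := @arg_minP _ _ _ (Ordinal N0) xpredT d isT.
have rowP1 : row k P *m P ^t* = delta_mx 0 k.
  by rewrite -row_mul (unitarymxP uP) row1.
exists (row k P).
  rewrite rowE trmx_mul map_mxM mulmxA -rowE rowP1.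
  apply/matrixP => i j; rewrite !ord1 !mxE (bigD1 k)//= big1.
    by rewrite !mxE !eqxx conjC1 mulr1 addr0.
  by move=> l /negPf lk; rewrite !mxE lk andbF mul0r.
rewrite (lambda_min_similar_diag (k := k)) ?unitarymx_unit//; last first.
  by move=> j; exact: dk.
rewrite /rayleigh unitary_diag_quadE// rowP1 (bigD1 k)//= big1.
  by rewrite mxE !eqxx normr1 expr1n mulr1 addr0.
by move=> l /negPf lk; rewrite mxE lk andbF normr0 expr0n mulr0.
Qed.

End Spectrum.

(** * The polytope of the SCM bound and its minimizer *)

Section SuccessiveConstraint.
Variables (R : realType) (P Q N J : nat).
Implicit Types (theta : 'I_Q -> 'cV[R]_P -> R) (A : 'I_Q -> 'M[R[i]]_N).
Implicit Types (mu : 'cV[R]_P) (C : 'I_J -> 'cV[R]_P) (x : 'rV[R[i]]_N).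

Lemma affine_mx_hermsym theta A mu : (forall q, A q \is hermsymmx) ->
  affine_mx theta A mu \is hermsymmx.
Proof.
move=> hA; apply/is_hermitianmxP; rewrite expr0 scale1r /affine_mx.
rewrite raddf_sum raddf_sum; apply: eq_bigr => q _ /=.
rewrite linearZ/= map_mxZ; congr (_ *: _).
  by apply/esym/CrealP/complex_realP; exists (theta q mu).
by rewrite {1}(is_hermitianmxP _ _ _ (hA q)) expr0 scale1r.
Qed.

Lemma affine_mx_real_diag theta (y : 'I_N -> 'cV[R]_Q) mu :
  affine_mx theta (fun q => real_diag_mx (fun k => y k q 0)) mu =
  real_diag_mx (fun k => theta_dot theta mu (y k)).
Proof.
apply/matrixP => j k; rewrite summxE !mxE rmorph_sum -sumrMnl.
by apply: eq_bigr => q _; rewrite !mxE mulrnAr rmorphM.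
Qed.

(** The quadratic form is linear in the matrix, and real coefficients pass through the real part. *)
Lemma rayleigh_affine theta A mu x :
  rayleigh (affine_mx theta A mu) x =
  theta_dot theta mu (\col_q rayleigh (A q) x).
Proof.
rewrite /rayleigh /affine_mx mulmx_sumr mulmx_suml summxE raddf_sum.
apply: eq_bigr => q _; rewrite -scalemxAr -scalemxAl !mxE.
by case: (\sum_(_ < N) _) => a b /=; rewrite mul0r subr0.
Qed.

(** Both kinds of constraint are Rayleigh bounds: those for each [A q] give the box, the lower ones
    for the matrices at the [C i] give the half-spaces. *)
Lemma rayleigh_Y_LB theta A C x : (forall q, A q \is hermsymmx) ->
  x *m x ^t* = 1%:M -> Y_LB theta A C (\col_q rayleigh (A q) x).
Proof.
move=> hA x1; split=> [q|i]; first by rewrite mxE rayleigh_bounds.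
rewrite -rayleigh_affine.
by have /andP[] := rayleigh_bounds (affine_mx_hermsym theta (C i) hA) x1.
Qed.

Lemma theta_dot_tr_continuous theta mu :
  continuous (fun z : 'rV[R]_Q => theta_dot theta mu z^T).
Proof.
apply: (@continuous_big _ _ _ _ _ (@add_continuous R) _ _
  (fun q (z : 'rV[R]_Q) => theta q mu * z^T q 0)) => q _ z.
apply: continuousM; first exact: cst_continuous.
have -> : (fun z : 'rV[R]_Q => z^T q 0) = (fun z => z 0 q).
  by apply/funext => u; rewrite mxE.
exact: coord_continuous.
Qed.

(* Row vectors, because compactness of boxes is only available for them. *)
Lemma Y_LB_tr_compact theta A C :
  compact [set z : 'rV[R]_Q | Y_LB theta A C z^T].
Proof.
pose B := [set z : 'rV[R]_Q |
  forall q, `[lambda_min (A q), lambda_max (A q)]%classic (z ord0 q)].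
pose S i := (fun z : 'rV[R]_Q => theta_dot theta (C i) z^T) @^-1`
  [set r | lambda_min (affine_mx theta A (C i)) <= r].
(* A compact box is cut by finitely many closed half-spaces. *)
have -> : [set z : 'rV[R]_Q | Y_LB theta A C z^T] = B `&` \bigcap_i S i.
  apply/seteqP; split=> z /= [Bz Sz]; split.
  - by move=> q; have := Bz q; rewrite mxE /= in_itv.
  - by move=> i _; exact: Sz.
  - by move=> q; have := Bz q; rewrite mxE /= in_itv.
  - by move=> i; exact: Sz.
apply: compact_closedI.
  apply: (@rV_compact R Q
    (fun q => `[lambda_min (A q), lambda_max (A q)]%classic)) => q.
  exact: segment_compact.
apply: closed_bigI => i _.
by move/continuous_closedP: (@theta_dot_tr_continuous theta (C i)); apply;
  exact: closed_ge.
Qed.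

(** By the extreme value theorem a continuous function on a nonempty compact set attains its
    minimum, so [min_set] does not fall back on its default value 0. *)
Lemma lambda_LB_attained theta A C mu : Y_LB theta A C !=set0 ->
  exists y, [/\ Y_LB theta A C y, lambda_LB theta A C mu = theta_dot theta mu y
    & forall z, Y_LB theta A C z -> theta_dot theta mu y <= theta_dot theta mu z].
Proof.
move=> [y0 Yy0].
have S0 : [set z : 'rV[R]_Q | Y_LB theta A C z^T] !=set0.
  by exists y0^T; rewrite /= trmxK.
have [z zS zmin] := compact_EVT_min S0 (@Y_LB_tr_compact theta A C)
  (continuous_subspaceT (@theta_dot_tr_continuous theta mu)).
have Yz : Y_LB theta A C z^T by rewrite inE in zS.
have ymin y : Y_LB theta A C y -> theta_dot theta mu z^T <= theta_dot theta mu y.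
  by move=> Yy; have := zmin y^T; rewrite trmxK; apply; rewrite inE /= trmxK.
exists z^T; split=> //; apply: min_setE; first by exists z^T.
by move=> _ [y Yy <-]; exact: ymin.
Qed.

End SuccessiveConstraint.

Theorem theorem2p3 (R : realType) (P Q N J : nat) (D : set 'cV[R]_P)
    (theta : 'I_Q -> 'cV[R]_P -> R) (A : 'I_Q -> 'M[R[i]]_N)
    (C : 'I_J -> 'cV[R]_P) (mut : 'cV[R]_P) :
  compact D ->
  (forall q, A q \is hermsymmx) ->
  (forall i, D (C i)) ->
  D mut ->
  (J < N)%N ->
  exists Abar : 'I_Q -> 'M[R[i]]_N,
    [/\ forall q, Abar q \is hermsymmx,
        lambda_min (affine_mx theta Abar mut) = lambda_LB theta A C mut
      & forall i, lambda_min (affine_mx theta Abar (C i)) =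
                  lambda_min (affine_mx theta A (C i))].
Proof.
move=> _ hA _ _ JN; have N0 : (0 < N)%N := leq_ltn_trans (leq0n J) JN.
have /choice[y yP] i : exists y, Y_LB theta A C y /\
    theta_dot theta (C i) y = lambda_min (affine_mx theta A (C i)).
  have [x x1 xmin] := rayleigh_lambda_min N0 (affine_mx_hermsym theta (C i) hA).
  exists (\col_q rayleigh (A q) x); split; first exact: rayleigh_Y_LB.
  by rewrite -rayleigh_affine.
have [y0 [Yy0 -> y0min]] : exists y0, [/\ Y_LB theta A C y0,
    lambda_LB theta A C mut = theta_dot theta mut y0
    & forall z, Y_LB theta A C z ->
        theta_dot theta mut y0 <= theta_dot theta mut z].
  apply: lambda_LB_attained.
  (* This unit vector shows that the polytope is nonempty; the points [y i] cannot serve, as J may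
     be 0. *)
  have [x x1 _] := rayleigh_lambda_min N0 (affine_mx_hermsym theta mut hA).
  by exists (\col_q rayleigh (A q) x); exact: rayleigh_Y_LB.
(* [insub] succeeds exactly for k < J, so [y0] fills all N - J remaining places, of which there is
   at least one. *)
pose Y (k : 'I_N) := oapp y y0 (insub (k : nat)).
have YP k : Y_LB theta A C (Y k).
  by rewrite /Y; case: insub => [i|] //=; have [] := yP i.
exists (fun q => real_diag_mx (fun k => Y k q 0)); split=> [q||i].
- exact: real_diag_mx_hermsym.
(* Counting from 0, index J is the first place after the [y i]. *)
- have Y0 : Y (Ordinal JN) = y0 by rewrite /Y insubN ?ltnn.
  rewrite affine_mx_real_diag (lambda_min_real_diag (k := Ordinal JN)) Y0//.
  by move=> j; exact: y0min.
- have Yi : Y (widen_ord (ltnW JN) i) = y i by rewrite /Y /= valK.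
  have [_ yi] := yP i.
  rewrite affine_mx_real_diag (lambda_min_real_diag (k := widen_ord (ltnW JN) i)).
    by rewrite Yi.
  (* Each [Y j] satisfies the i-th constraint of the polytope, and [y i] satisfies it with
     equality. *)
  by move=> j; rewrite Yi yi; have [_] := YP j.
Qed.
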